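(* For any countable ring $R$ with unit (not necessarily commutative), the class of countable tagged left $R$-modules is Borel complete.
   Context: A tagged left $R$-module is a left $R$-module $V$ (in the language $\{+,0\}\cup\{\cdot_r:r\in R\}$) expanded by countably many unary predicates $V_n$ ($n\in\omega$), each interpreted as a left $R$-submodule of $V$. A class of countable structures is Borel complete if every class of countable structures in a countable language Borel reduces to it, i.e. for each such class there is a Borel map $f$ on the Polish spaces of structures with universe $\omega$ with $f(M)\cong f(N)$ iff $M\cong N$. *)

(* Defs.v *)
From HB Require Import structures.
From mathcomp Require Import all_boot all_algebra.
From mathcomp Require Import boolp classical_sets topology measure.

Set Implicit Arguments.
Unset Strict Implicit.
Unset Printing Implicit Defensive.

Local Open Scope classical_set_scope.

Record language := Language {
  rel_sym : countType;
  fun_sym : countType;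
  rel_arity : rel_sym -> nat;
  fun_arity : fun_sym -> nat (* constants are function symbols of arity 0 *)
}.

(* The space of L-structures with universe nat: a pair of interpretations (of
   the relation symbols, of the function symbols), with the product topology
   over the discrete spaces bool and nat.  It is Polish because L is
   countable. *)
Definition structure (L : language) : topologicalType :=
  (prod_topology (fun r : rel_sym L =>
     {ptws (rel_arity r).-tuple nat -> bool}) *
   prod_topology (fun f : fun_sym L =>
     {ptws (fun_arity f).-tuple nat -> nat}))%type.

Definition rel_interp (L : language) (M : structure L) (r : rel_sym L) :
  (rel_arity r).-tuple nat -> bool := M.1 r.

Definition fun_interp (L : language) (M : structure L) (f : fun_sym L) :
  (fun_arity f).-tuple nat -> nat := M.2 f.

Definition iso (L : language) (M N : structure L) : Prop :=
  exists h : nat -> nat,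
    [/\ bijective h,
        forall (r : rel_sym L) (t : (rel_arity r).-tuple nat),
          rel_interp N (map_tuple h t) = rel_interp M t
      & forall (f : fun_sym L) (t : (fun_arity f).-tuple nat),
          fun_interp N (map_tuple h t) = h (fun_interp M t)].

Definition iso_closed (L : language) (K : set (structure L)) : Prop :=
  forall M N : structure L, iso M N -> K M -> K N.

Definition borel (T : topologicalType) : set (set T) := <<s @open T >>.

(* f restricted to D is a Borel map, D carrying its subspace Borel structure;
   D itself need not be Borel, which is why this is not [measurable_fun]. *)
Definition borel_map_on (T U : topologicalType) (D : set T) (f : T -> U) :
  Prop :=
  forall B : set U, borel B ->
    exists2 C : set T, borel C & D `&` f @^-1` B = D `&` C.

Definition borel_reducible (L L' : language)
    (K : set (structure L)) (K' : set (structure L')) : Prop :=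
  exists f : structure L -> structure L',
    [/\ borel_map_on K f,
        forall M, K M -> K' (f M)
      & forall M N, K M -> K N -> (iso (f M) (f N) <-> iso M N)].

Definition borel_complete (L : language) (K : set (structure L)) : Prop :=
  forall (L' : language) (K' : set (structure L')),
    iso_closed K' -> borel_reducible K' K.

Inductive module_sym (R : Type) := Zero | Add | Scale of R.
Arguments Zero {R}.
Arguments Add {R}.

Definition module_sym_code (R : Type) (s : module_sym R) : option (option R) :=
  match s with Zero => None | Add => Some None | Scale r => Some (Some r) end.

Definition module_sym_decode (R : Type) (c : option (option R)) :
  module_sym R :=
  match c with None => Zero | Some None => Add | Some (Some r) => Scale r end.

Lemma module_sym_codeK (R : Type) :
  cancel (@module_sym_code R) (@module_sym_decode R).
Proof. by case. Qed.

HB.instance Definition _ (R : countType) :=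
  Countable.copy (module_sym R) (can_type (@module_sym_codeK R)).

Definition module_sym_arity (R : Type) (s : module_sym R) : nat :=
  match s with Zero => 0 | Add => 2 | Scale _ => 1 end.

Definition tagged_module_language (R : countType) : language :=
  @Language nat (module_sym R) (fun=> 1) (@module_sym_arity R).

Section TaggedModule.
Variables (R : countNzRingType) (M : structure (tagged_module_language R)).

Definition mod_zero : nat :=
  @fun_interp (tagged_module_language R) M Zero [tuple].
Definition mod_add (x y : nat) : nat :=
  @fun_interp (tagged_module_language R) M Add [tuple x; y].
Definition mod_scale (a : R) (x : nat) : nat :=
  @fun_interp (tagged_module_language R) M (Scale a) [tuple x].
Definition mod_tag (n x : nat) : bool :=
  @rel_interp (tagged_module_language R) M n [tuple x].

Definition is_left_module : Prop :=
  [/\ [/\ associative mod_add, commutative mod_add, left_id mod_zero mod_add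
        & forall x, exists y, mod_add y x = mod_zero],
      forall a b x, mod_scale a (mod_scale b x) = mod_scale (a * b)%R x,
      forall x, mod_scale 1%R x = x,
      forall a x y,
        mod_scale a (mod_add x y) = mod_add (mod_scale a x) (mod_scale a y)
    & forall a b x,
        mod_scale (a + b)%R x = mod_add (mod_scale a x) (mod_scale b x)].

(* Closure under opposites follows by scaling by -1. *)
Definition is_submodule (V : pred nat) : Prop :=
  [/\ V mod_zero,
      forall x y, V x -> V y -> V (mod_add x y)
    & forall a x, V x -> V (mod_scale a x)].

Definition is_tagged_module : Prop :=
  is_left_module /\ forall n, is_submodule (mod_tag n).

End TaggedModule.

Definition tagged_modules (R : countNzRingType) :
  set (structure (tagged_module_language R)) :=
  [set M | is_tagged_module M].

(* Main.v *)
Require Import Defs.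
From mathcomp Require Import all_boot all_algebra.
From mathcomp Require Import boolp classical_sets cardinality functions topology measure.

(* Fix a maximal left ideal [m] of [R] and let [V] be the free left R-module on
   a countable set [D] of basis vectors; every tag contains [mV], so that
   coefficients only matter modulo [m] and behave as over a division ring.

   A module built functorially from a set has endomorphisms mixing its basis
   vectors (linear combinations of permutations), so [D] is chosen generic
   instead.  Its points are labelled by finite sequences of naturals, and its
   finite tuples are coloured so that (a) for each colour [j] and vector [w] of
   coefficients, the tag spanned by the combinations [sum_i w_i F_i], with [F]
   of colour [j], contains no multiple of a single basis vector outside [mV],
   while (b) finite approximations of a lift can always be extended by a point,
   so that every permutation of the naturals lifts to a colour-preserving
   permutation of [D].  By (a) an isomorphism respecting the tags maps each
   basis vector to a multiple of a basis vector: otherwise its image would lie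
   in the tag of its own support, whereas the basis vector does not.  Hence it
   permutes [D]; further tags force this permutation to come from a permutation
   of the labels' entries, and tags depending on a structure [M] record the
   relations and the graphs of functions of [M].

   The colouring is made by recursion: the point [n] copies, over a finite set
   [b], the type of an earlier point [y] over a set [a] isomorphic to [b], and
   every other tuple with greatest element [n] receives itself as a new
   colour.  Thus for each colour [j] a new point lies in at most one tuple of
   colour [j] whose other points are older; this triangularity yields (a). *)

Set Implicit Arguments.
Unset Strict Implicit.
Unset Printing Implicit Defensive.

(** * The generic coloured set *)

Lemma allSn (n : nat) (s : seq nat) : all (ltn^~ n) s -> all (ltn^~ n.+1) s.
Proof. by apply: sub_all => x /= /ltnW. Qed.

Lemma all_ltnS (n : nat) (s : seq nat) :
  all (ltn^~ n.+1) s -> n \notin s -> all (ltn^~ n) s.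
Proof.
move=> /allP h ns; apply/allP => x xs /=; have /= := h x xs.
by rewrite ltnS leq_eqVlt => /orP[/eqP xn|//]; rewrite -xn xs in ns.
Qed.

Definition relabel (a b : seq nat) (x : nat) : nat := nth 0 b (index x a).

Section Relabel.
Variables (a b : seq nat).
Hypothesis (sab : size a = size b).

Lemma relabel_in x : x \in a -> relabel a b x \in b.
Proof. by move=> xa; rewrite mem_nth // -sab index_mem. Qed.

Hypothesis (ub : uniq b).

Lemma relabelK x : x \in a -> relabel b a (relabel a b x) = x.
Proof.
by move=> xa; rewrite /relabel index_uniq ?nth_index // -sab index_mem.
Qed.

Lemma relabel_inj : {in a &, injective (relabel a b)}.
Proof. by move=> x y xa ya e; rewrite -(relabelK xa) e relabelK. Qed.

Lemma map_relabelK F : {subset F <= a} ->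
  map (relabel b a) (map (relabel a b) F) = F.
Proof.
move=> Fa; rewrite -map_comp -[RHS]map_id; apply/eq_in_map => x xF /=.
exact/relabelK/Fa.
Qed.

Lemma map_relabel_uniq F : {subset F <= a} -> uniq F -> uniq (map (relabel a b) F).
Proof.
by move=> Fa uF; rewrite map_inj_in_uniq // => x y /Fa xa /Fa ya; exact: relabel_inj.
Qed.

Lemma map_relabel_sub F : {subset F <= a} -> {subset map (relabel a b) F <= b}.
Proof. by move=> Fa y /mapP[x /Fa xa ->]; exact: relabel_in. Qed.

End Relabel.

Lemma relabel_head x y a b : relabel (x :: a) (y :: b) x = y.
Proof. by rewrite /relabel /= eqxx. Qed.

Lemma relabel_behead x y a b z : z != x ->
  relabel (x :: a) (y :: b) z = relabel a b z.
Proof. by rewrite /relabel /= eq_sym => /negPf->. Qed.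

Implicit Types (c : seq nat -> seq nat) (A B F : seq nat).

(** The relabelling runs from [B] back to [A], the direction in which a new point over [B] copies
    the colours of an old one over [A]. *)
Definition color_iso c A B :=
  forall F, uniq F -> {subset F <= B} -> c (map (relabel B A) F) = c F.

Definition separated c A x :=
  forall F G, uniq F -> uniq G -> {subset F <= x :: A} -> {subset G <= x :: A} ->
    x \in F -> x \in G -> c F = c G -> F = G.

(* Points added this way do not enlarge the spans of coloured tuples within [A];
   see [edge_span_restrict]. *)
Inductive grows c A : seq nat -> Prop :=
| grows_refl : grows c A A
| grows_step B x : grows c A B -> x \notin B -> separated c B x ->
    grows c A (x :: B).

(** The analogue of a self-sufficient subset in amalgamation constructions; [=i] forgets the order
    in which points were added. *)
Definition strong c A n := exists2 B, grows c A B & B =i iota 0 n.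

Lemma grows_sub c A B : grows c A B -> {subset A <= B}.
Proof. by elim=> // {}B x _ IH _ _ y /IH yB; rewrite inE yB orbT. Qed.

Lemma grows_trans c A B C : grows c A B -> grows c B C -> grows c A C.
Proof. by move=> AB; elim=> // {}C x _ AC xC sC; exact: grows_step. Qed.

Lemma eq_separated c A B x : A =i B -> separated c A x -> separated c B x.
Proof.
move=> AB sA F G uF uG FB GB; apply: sA => // z zF.
  by rewrite inE AB -in_cons FB.
by rewrite inE AB -in_cons GB.
Qed.

Lemma eq_grows_step c A B C x : grows c A B -> B =i C -> x \notin C ->
  separated c C x -> grows c A (x :: B).
Proof.
move=> AB BC xC sC; apply: grows_step => //; first by rewrite BC.
by apply: (eq_separated _ sC) => z; rewrite BC.
Qed.

(* The task [(a, b, y, i)] asks for a point labelled [i] that realizes over [b]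
   the type of [y] over [a]. *)
Definition task : Type := (seq nat * seq nat * nat * seq nat)%type.

(** The discarded first component of the code makes every task recur infinitely often. *)
Definition task_at (n : nat) : task :=
  if (unpickle n : option (nat * task)) is Some (_, t) then t
  else (nil, nil, 0, nil).

Lemma task_at_frequently (t : task) (m : nat) :
  exists2 n, m <= n & task_at n = t.
Proof.
apply: contrapT => none; pose p (k : nat) := pickle (k, t).
have lt_p (k : nat) : p k < m.
  rewrite ltnNge; apply/negP => mk; apply: none; exists (p k) => //.
  by rewrite /task_at /p pickleK.
have p_inj : injective (fun k : 'I_m.+1 => Ordinal (lt_p k)).
  move=> k l /(congr1 val) /= /(pcan_inj pickleK) [kl]; exact: val_inj.
by have := leq_card _ p_inj; rewrite !card_ord ltnn.
Qed.

(** Separation of [y] makes the new point separated in turn; strength of [b] lets combinations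
    supported on [b] be rewritten with tuples inside [b]. *)
Definition valid c n (t : task) : Prop :=
  let: (a, b, y, _) := t in
  [/\ [/\ uniq (y :: a), uniq b & size a = size b],
      all (ltn^~ n) (y :: a), all (ltn^~ n) b
    & [/\ color_iso c a b, separated c a y & strong c b n]].

(** A colour is the tuple at which a chain of copies ends. Validity is tested with the colouring of
    the points below [m], which keeps the recursion structural. *)
Fixpoint color_below (n : nat) (F : seq nat) : seq nat :=
  if n isn't m.+1 then F else
  if m \notin F then color_below m F else
  let: (a, b, y, _) := task_at m in
  if `[< valid (color_below m) m (task_at m) >] && all [in m :: b] F
  then color_below m (map (relabel (m :: b) (y :: a)) F) else F.

Definition color (F : seq nat) : seq nat := color_below (\max_(x <- F) x).+1 F.

Definition label_of (n : nat) : seq nat := (task_at n).2.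

Lemma color_below_stable m n F : m <= n -> all (ltn^~ m) F ->
  color_below n F = color_below m F.
Proof.
move=> mn Fm; elim: n mn => [|n IH]; first by rewrite leqn0 => /eqP->.
rewrite leq_eqVlt => /orP[/eqP->//|mn] /=.
case: ifPn => [_|/negPn nF]; first exact: IH.
by have /= := allP Fm n nF; rewrite ltnNge -ltnS mn.
Qed.

Lemma color_belowE n F : all (ltn^~ n) F -> color_below n F = color F.
Proof.
move=> Fn; rewrite /color; set m := _.+1.
have Fm : all (ltn^~ m) F.
  by apply/allP => x xF /=; rewrite ltnS (big_rem x) //= leq_maxl.
case: (leqP n m) => [nm|/ltnW mn]; first by rewrite (color_below_stable nm).
by rewrite -(color_below_stable mn).
Qed.

Lemma grows_eq_below c1 c2 n A B :
  (forall F, all (ltn^~ n) F -> c1 F = c2 F) -> all (ltn^~ n) B ->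
  grows c1 A B -> grows c2 A B.
Proof.
move=> c12 Bn AB; elim: AB Bn => [|{}B x _ IH xB sB] Bn; first exact: grows_refl.
have /andP[_ Bn'] := Bn; apply: grows_step => //; first exact: IH.
move=> F G uF uG FB GB xF xG.
have lt_n H : {subset H <= x :: B} -> all (ltn^~ n) H.
  by move=> HB; apply/allP => z /HB; exact: (allP Bn).
by rewrite -(c12 F) ?lt_n // -(c12 G) ?lt_n //; exact: sB.
Qed.

Lemma valid_eq_below c1 c2 n t :
  (forall F, all (ltn^~ n) F -> c1 F = c2 F) -> valid c1 n t -> valid c2 n t.
Proof.
case: t => [[[a b] y] i] c12 [[uya ub sab] yan bn [isoab sepa [B gB Bn]]].
have lt_sub s F : all (ltn^~ n) s -> {subset F <= s} -> all (ltn^~ n) F.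
  by move=> /allP sn Fs; apply/allP => z /Fs; exact: sn.
have an : all (ltn^~ n) a by case/andP: yan.
split => //; split.
- move=> F uF Fb; rewrite -(c12 F); last exact: lt_sub Fb.
  rewrite -(c12 (map _ _)); first exact: isoab.
  by apply: (lt_sub a) => //; apply: map_relabel_sub.
- move=> F G uF uG Fa Ga yF yG.
  rewrite -(c12 F); last exact: lt_sub Fa.
  by rewrite -(c12 G); [exact: sepa | exact: lt_sub Ga].
- exists B => //; apply: (grows_eq_below c12 _ gB).
  by apply/allP => z; rewrite Bn mem_iota.
Qed.

Lemma color_top n F : n \in F -> all (ltn^~ n.+1) F ->
  color F = let: (a, b, y, _) := task_at n in
    if `[< valid color n (task_at n) >] && all [in n :: b] F
    then color (map (relabel (n :: b) (y :: a)) F) else F.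
Proof.
move=> nF Fn; rewrite -(color_belowE Fn) /= nF /=.
have -> : `[< valid (color_below n) n (task_at n) >] =
          `[< valid color n (task_at n) >].
  apply: asbool_equiv_eq; split; apply: valid_eq_below => G Gn;
  by rewrite (color_belowE Gn).
case: (task_at n) => [[[a b] y] i] /=.
case: ifP => // /andP[/asboolP[[_ _ sab] yan _ _] /allP Fb].
apply: color_belowE; apply/allP => z zF.
apply: (allP (yan : all (ltn^~ n) (y :: a))).
by apply: map_relabel_sub zF => //=; rewrite sab.
Qed.

Lemma color_fresh_or_copy n F : n \in F -> all (ltn^~ n.+1) F ->
  color F = F \/
  exists a b y i, [/\ task_at n = (a, b, y, i), valid color n (a, b, y, i),
    {subset F <= n :: b} & color F = color (map (relabel (n :: b) (y :: a)) F)].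
Proof.
move=> nF Fn; rewrite (color_top nF Fn).
case E : (task_at n) => [[[a b] y] i].
case: ifP => [/andP[/asboolP v /allP Fb]|_]; last by left.
by right; exists a, b, y, i.
Qed.

(** Copies only descend to older points. Hence a fresh colour with greatest point [n] does not occur
    among the tuples below [n]. *)
Lemma color_lt n F : all (ltn^~ n) F -> all (ltn^~ n) (color F).
Proof.
elim: n F => [|n IH] F Fn.
  suff -> : F = nil by rewrite /color big_nil.
  by case: F Fn.
have [nF|nF] := boolP (n \in F); last exact/allSn/IH/all_ltnS.
have [->//|[a [b [y [i [_ [[_ _ sab] yan _ _] Fb ->]]]]]] :=
  color_fresh_or_copy nF Fn.
apply/allSn/IH/allP => z zF; apply: (allP yan).
by apply: map_relabel_sub zF => //=; rewrite sab.
Qed.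

(** A fresh colour contains [n] and a copied one does not. Two copies at [n] come from the same
    task, so separation of [y] over [a] pulls back along the relabelling. *)
Lemma color_separated n : separated color (iota 0 n) n.
Proof.
move=> F G uF uG; have lt_n H : {subset H <= n :: iota 0 n} -> all (ltn^~ n.+1) H.
  by move=> Hn; apply/allP => z /Hn; rewrite inE mem_iota /= add0n ltnS (leq_eqVlt z).
move=> /lt_n Fn /lt_n Gn nF nG.
have copy_lt a b y i H : valid color n (a, b, y, i) -> {subset H <= n :: b} ->
    n \notin color (map (relabel (n :: b) (y :: a)) H).
  move=> [[_ _ sab] yan _ _] Hb; apply/negP => nH.
  suff /color_lt/allP/(_ n nH) : all (ltn^~ n)
      (map (relabel (n :: b) (y :: a)) H) by rewrite /= ltnn.
  by apply/allP => z zF; apply: (allP yan); apply: map_relabel_sub zF => //=; rewrite sab.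
have [-> | [a [b [y [i [E v Fb ->]]]]]] := color_fresh_or_copy nF Fn;
have [-> | [a' [b' [y' [i' [E' v' Gb ->]]]]]] := color_fresh_or_copy nG Gn => //.
- by move=> e; have := copy_lt _ _ _ _ _ v' Gb; rewrite -e nF.
- by move=> e; have := copy_lt _ _ _ _ _ v Fb; rewrite e nG.
case: (congr1 fst (etrans (esym E) E')) => ? ? ?; subst a' b' y'.
have [[uya ub sab] _ bn [_ sep _]] := v.
have snb : size (n :: b) = size (y :: a) by rewrite /= sab.
have yr H : n \in H -> y \in map (relabel (n :: b) (y :: a)) H.
  by move=> nH; rewrite -{1}(relabel_head n y b a) map_f.
move=> /sep e.
rewrite -(map_relabelK snb uya Fb) -(map_relabelK snb uya Gb) e //.
- exact: map_relabel_uniq.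
- exact: map_relabel_uniq.
- exact: map_relabel_sub.
- exact: map_relabel_sub.
- exact: yr.
- exact: yr.
Qed.

Lemma grows_iota n m : n <= m -> exists2 B, grows color (iota 0 n) B & B =i iota 0 m.
Proof.
elim: m => [|m IH]; first by rewrite leqn0 => /eqP->; exists nil; first exact: grows_refl.
rewrite leq_eqVlt => /orP[/eqP->|/IH[B gB Bm]].
  by exists (iota 0 m.+1); first exact: grows_refl.
exists (m :: B).
  apply: (eq_grows_step gB Bm); first by rewrite mem_iota ltnn.
  exact: color_separated.
by move=> z; rewrite inE Bm !mem_iota /= !add0n ltnS (leq_eqVlt z).
Qed.

Lemma eq_grows c A A' B : A =i A' -> grows c A B ->
  exists2 B', grows c A' B' & B' =i B.
Proof.
move=> AA'; elim=> [|{}B x _ [B' gB' BB'] xB sB]; first by exists A'; first exact: grows_refl.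
exists (x :: B'); first by apply: (eq_grows_step gB' BB').
by move=> z; rewrite !inE BB'.
Qed.

(** Every later point is separated over all earlier ones, so strength persists. *)
Lemma strong_le A n m : n <= m -> strong color A n -> strong color A m.
Proof.
move=> nm [B gB Bn]; have [C gC Cm] := grows_iota nm.
have [B' gB' B'C] := eq_grows (fun z => esym (Bn z)) gC.
exists B'; first exact: grows_trans gB'.
by move=> z; rewrite B'C Cm.
Qed.

Lemma color_fresh n F a b y i : task_at n = (a, b, y, i) -> n \in F ->
  all (ltn^~ n.+1) F -> ~ {subset F <= n :: b} -> color F = F.
Proof.
move=> E nF Fn Fb; have [//|[a' [b' [y' [i' [E' _ Fb' _]]]]]] :=
  color_fresh_or_copy nF Fn.
by case: (congr1 fst (etrans (esym E) E')) => _ bb' _; rewrite -bb' in Fb'.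
Qed.

(** The point [n] can be moved ahead of the points of [B] outside [b]: a tuple containing [n] and
    such a point is not inside [n :: b], hence is its own colour. *)
Lemma grows_cons_top n a b y i B : task_at n = (a, b, y, i) ->
  grows color b B -> all (ltn^~ n) B ->
  exists2 C, grows color (n :: b) C & C =i n :: B.
Proof.
move=> E gB; elim: gB => [|{}B x bB IH xB sB] Bn.
  by exists (n :: b); first exact: grows_refl.
have /andP[/= xn Bn'] := Bn; have [C gC CB] := IH Bn'.
exists (x :: C); last by move=> z; rewrite !inE CB inE orbCA.
have xnB : x \notin n :: B by rewrite inE negb_or xB neq_ltn xn.
apply: (eq_grows_step gC CB) => // F G uF uG FB GB xF xG.
have lt_n H : {subset H <= x :: n :: B} -> all (ltn^~ n.+1) H.
  move=> HB; apply/allP => z /HB; rewrite !inE => /or3P[/eqP->|/eqP->|zB] /=.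
  - exact: ltnW.
  - exact: ltnSn.
  - by apply: ltnW; apply: (allP Bn').
have fresh H : {subset H <= x :: n :: B} -> x \in H -> n \in H -> color H = H.
  move=> HB xH nH; apply: (color_fresh E nH (lt_n _ HB)) => /(_ x xH) xnb.
  move: xnB; rewrite inE; move: xnb; rewrite inE => /orP[->//|/(grows_sub bB)->].
  by rewrite orbT.
have old H : {subset H <= x :: n :: B} -> n \notin H -> {subset H <= x :: B}.
  move=> HB nH z zH; have := HB z zH; rewrite !inE => /or3P[->//|/eqP zn|->].
    by rewrite -zn zH in nH.
  by rewrite orbT.
have old_color H : {subset H <= x :: n :: B} -> n \notin H -> n \notin color H.
  move=> HB nH; apply/negP => /(allP (color_lt (all_ltnS (lt_n _ HB) nH))) /=.
  by rewrite ltnn.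
have [nF|nF] := boolP (n \in F); have [nG|nG] := boolP (n \in G).
- by rewrite !fresh.
- by rewrite fresh // => e; have := old_color G GB nG; rewrite -e nF.
- by rewrite (fresh G) // => e; have := old_color F FB nF; rewrite e nG.
- by apply: sB => //; exact: old.
Qed.

Lemma iota_ltn n s : {subset s <= iota 0 n} -> all (ltn^~ n) s.
Proof. by move=> sn; apply/allP => z /sn; rewrite mem_iota. Qed.

Lemma strong_lt c A n : strong c A n -> all (ltn^~ n) A.
Proof.
by move=> [B gB Bn]; apply: iota_ltn => z /(grows_sub gB); rewrite Bn.
Qed.

(** * Lifting permutations by back-and-forth *)

Definition transfers (p : nat -> nat) (l : seq (nat * nat)) : Prop :=
  [/\ uniq (unzip1 l), uniq (unzip2 l), color_iso color (unzip1 l) (unzip2 l)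
    & {in l, forall q, label_of q.2 = map p (label_of q.1)}].

Lemma transfer_point p l y : transfers p l -> y \notin unzip1 l ->
  separated color (unzip1 l) y -> (exists n, strong color (unzip2 l) n) ->
  exists2 z, transfers p ((y, z) :: l) &
    exists n, strong color (unzip2 ((y, z) :: l)) n.
Proof.
move=> [ua ub isol il] ya sepa [m sm].
set a := unzip1 l in ua isol ya sepa *; set b := unzip2 l in ub isol sm *.
have sab : size a = size b by rewrite !size_map.
pose i := map p (label_of y).
(* The stage is taken beyond [y :: a] and beyond one where [b] is strong, so that the task is valid
   there. *)
have [n] := task_at_frequently (a, b, y, i) (maxn m (\max_(x <- y :: a) x).+1).
rewrite geq_max => /andP[mn yan] E.
have sn := strong_le mn sm; have bn := strong_lt sn.
have {}yan : all (ltn^~ n) (y :: a).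
  apply/allP => x xya /=; apply: leq_trans yan.
  by rewrite ltnS (big_rem x) //= leq_maxl.
have nb : n \notin b by apply/negP => /(allP bn) /=; rewrite ltnn.
have v : valid color n (a, b, y, i) by split=> //=; rewrite ya.
exists n; last first.
  have [B gB Bn] := sn.
  have Bn' : all (ltn^~ n) B by apply: iota_ltn => z; rewrite Bn.
  have [C gC CB] := grows_cons_top E gB Bn'.
  exists n.+1, C => // z.
  by rewrite CB inE Bn !mem_iota /= !add0n ltnS (leq_eqVlt z).
split => /=; [by rewrite ya|by rewrite nb| |].
- move=> F uF Fb; have [nF|nF] := boolP (n \in F).
    rewrite [RHS](color_top nF).
      by rewrite E; case: ifPn => // /negP[]; apply/andP; split; [apply/asboolP|apply/allP].
    by apply/allP => z /Fb; rewrite inE => /orP[/eqP->|/(allP bn)/ltnW] //=.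
  have Fb' : {subset F <= b}.
    move=> z zF; have := Fb z zF; rewrite inE => /orP[/eqP zn|//].
    by rewrite -zn zF in nF.
  rewrite -[RHS]isol //; congr color; apply/eq_in_map => z zF.
  by rewrite relabel_behead //; apply: contraNneq nF => <-.
- by move=> q; rewrite inE => /orP[/eqP->|/il//]; rewrite /= /label_of E.
Qed.

Lemma transfer_grows p l B : transfers p l ->
  (exists n, strong color (unzip2 l) n) -> grows color (unzip1 l) B ->
  exists t, [/\ unzip1 (t ++ l) = B, transfers p (t ++ l)
    & exists n, strong color (unzip2 (t ++ l)) n].
Proof.
move=> tl sl; elim=> [|{}B x _ [t [<- tt st]] xB sB]; first by exists nil.
have [z tz sz] := transfer_point tt xB sB st.
by exists ((x, z) :: t).
Qed.

Definition swaps (l : seq (nat * nat)) := [seq (q.2, q.1) | q <- l].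

Lemma unzip1_swaps l : unzip1 (swaps l) = unzip2 l.
Proof. by rewrite /unzip1 -map_comp. Qed.

Lemma unzip2_swaps l : unzip2 (swaps l) = unzip1 l.
Proof. by rewrite /unzip2 -map_comp. Qed.

Lemma swapsK : involutive swaps.
Proof. by move=> l; rewrite /swaps -map_comp map_id_in // => -[]. Qed.

Lemma transfers_swaps p p' l : cancel p p' -> transfers p l -> transfers p' (swaps l).
Proof.
move=> pK [ua ub isol il]; split; rewrite ?unzip1_swaps ?unzip2_swaps //.
  have sab : size (unzip1 l) = size (unzip2 l) by rewrite !size_map.
  move=> F uF Fa; rewrite -isol ?map_relabelK //; first exact: map_relabel_uniq.
  exact: map_relabel_sub.
by move=> _ /mapP[q ql ->] /=; rewrite (il q ql) mapK.
Qed.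

Definition position p l := [/\ transfers p l,
  exists n, strong color (unzip1 l) n & exists n, strong color (unzip2 l) n].

Lemma position_swaps p p' l : cancel p p' -> position p l -> position p' (swaps l).
Proof.
move=> pK [tl sa sb]; split; first exact: transfers_swaps tl.
  by rewrite unzip1_swaps.
by rewrite unzip2_swaps.
Qed.

(** The point [x] alone need not be separated over the domain, so the domain grows to a whole
    initial segment containing [x], one separated point at a time. *)
Lemma position_forth p l x : position p l ->
  exists2 t, position p (t ++ l) & x \in unzip1 (t ++ l).
Proof.
move=> [tl [m sm] sb].
have [B gB Bn] := strong_le (leq_maxl m x.+1) sm.
have [t [tB tt st]] := transfer_grows tl sb gB.
exists t; last by rewrite tB Bn mem_iota add0n leq_maxr.
split=> //; rewrite tB; exists (maxn m x.+1), B => //; exact: grows_refl.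
Qed.

Lemma position_back p p' l x : cancel p p' -> cancel p' p -> position p l ->
  exists2 t, position p (t ++ l) & x \in unzip2 (t ++ l).
Proof.
move=> pK p'K /(position_swaps pK)/(position_forth x)[t tt xt].
exists (swaps t); last by rewrite -unzip1_swaps /swaps map_cat -!/(swaps _) swapsK.
by have := position_swaps p'K tt; rewrite {1}/swaps map_cat -!/(swaps _) swapsK.
Qed.

Lemma mem_unzip_inj (T U : eqType) (l : seq (T * U)) (q r : T * U) :
  uniq (unzip1 l) -> q \in l -> r \in l -> q.1 = r.1 -> q = r.
Proof.
elim: l => //= s l IH /andP[sl ul]; rewrite !inE.
have notin (t : T * U) : t \in l -> t.1 != s.1.
  by move=> tl; apply: contraNneq sl => <-; exact: map_f.
move=> /orP[/eqP->|ql] /orP[/eqP->|rl] // e; last exact: IH.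
  by have := notin r rl; rewrite -e eqxx.
by have := notin q ql; rewrite e eqxx.
Qed.

Lemma relabel_unzip (l : seq (nat * nat)) x y : uniq (unzip1 l) -> (x, y) \in l ->
  relabel (unzip1 l) (unzip2 l) x = y.
Proof.
elim: l => //= -[x' y'] l IH /= /andP[xl ul]; rewrite inE.
case/orP => [/eqP[-> ->]|xyl]; first exact: relabel_head.
rewrite relabel_behead ?IH //; apply: contraNneq xl => <-.
by rewrite -[x]/((x, y).1) map_f.
Qed.

(** The last clause puts the restriction of [s] to any finite set inside one list satisfying [P], so
    finitary properties pass to the limit. *)
Lemma back_and_forth (P : seq (nat * nat) -> Prop) :
  P nil -> (forall l, P l -> uniq (unzip1 l) /\ uniq (unzip2 l)) ->
  (forall l x, P l -> exists2 t, P (t ++ l) & x \in unzip1 (t ++ l)) ->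
  (forall l x, P l -> exists2 t, P (t ++ l) & x \in unzip2 (t ++ l)) ->
  exists2 s : nat -> nat, bijective s &
    forall F : seq nat, exists2 l, P l & {in F, forall x, (x, s x) \in l}.
Proof.
move=> P0 Pu forth back.
have /choice[next nextP] (kl : nat * {l | P l}) : exists l' : {l | P l},
    [/\ {subset sval kl.2 <= sval l'}, kl.1 \in unzip1 (sval l')
      & kl.1 \in unzip2 (sval l')].
  case: kl => k [l Pl] /=; have [t Pt kt] := forth l k Pl.
  have [u Pu' ku] := back _ k Pt; exists (exist _ _ Pu') => /=; split => //.
    by move=> z zl; rewrite !mem_cat zl !orbT.
  by rewrite /unzip1 map_cat mem_cat kt orbT.
pose L := fix L k := if k is k'.+1 then next (k', L k') else exist P nil P0.
have L_sub k m : k <= m -> {subset sval (L k) <= sval (L m)}.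
  elim: m => [|m IH]; first by rewrite leqn0 => /eqP->.
  rewrite leq_eqVlt => /orP[/eqP->//|/IH km z /km].
  by have [sub _ _] := nextP (m, L m); exact: sub.
have uL k : uniq (unzip1 (sval (L k))) /\ uniq (unzip2 (sval (L k))).
  by apply: Pu; exact: svalP.
have /choice[s sP] x : exists y, (x, y) \in sval (L x.+1).
  have [_ /mapP[[x' y] xy /= xx'] _] := nextP (x, L x).
  by exists y; rewrite {1}xx'.
have /choice[s' s'P] y : exists x, (x, y) \in sval (L y.+1).
  have [_ _ /mapP[[x y'] xy /= yy']] := nextP (y, L y).
  by exists x; rewrite {1}yy'.
exists s; last first.
  move=> F; exists (sval (L (\max_(x <- F) x).+1)); first exact: svalP.
  move=> x xF; apply: L_sub (sP x).
  by rewrite ltnS (big_rem x) //= leq_maxl.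
(* Both pairs lie in a common stage of the chain, where no coordinate repeats. *)
exists s' => x.
  set m := maxn x.+1 (s x).+1.
  have h1 := L_sub _ m (leq_maxl _ _) _ (sP x).
  have h2 := L_sub _ m (leq_maxr _ _) _ (s'P (s x)).
  have sw q : q \in sval (L m) -> (q.2, q.1) \in swaps (sval (L m)).
    exact: (map_f (fun q : nat * nat => (q.2, q.1))).
  have := mem_unzip_inj _ (sw _ h1) (sw _ h2) erefl.
  by rewrite unzip1_swaps => /(_ (proj2 (uL m))) [].
set m := maxn x.+1 (s' x).+1.
have h1 := L_sub _ m (leq_maxl _ _) _ (s'P x).
have h2 := L_sub _ m (leq_maxr _ _) _ (sP (s' x)).
by case: (mem_unzip_inj (proj1 (uL m)) h1 h2 erefl).
Qed.

Lemma lift_permutation (p : nat -> nat) : bijective p ->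
  exists s : nat -> nat, [/\ bijective s,
    forall F, uniq F -> color (map s F) = color F
  & forall x, label_of (s x) = map p (label_of x)].
Proof.
move=> [p' pK p'K].
have [||||s bs sP] := @back_and_forth (position p).
- split; last by exists 0, nil; first exact: grows_refl.
    by split=> // F uF; case: F uF => // x F _ /(_ x); rewrite inE eqxx => /(_ isT).
  by exists 0, nil; first exact: grows_refl.
- by move=> l [[]].
- by move=> l x; exact: position_forth.
- by move=> l x; exact: position_back.
exists s; split=> // [F uF|x]; last first.
  have [l [[_ _ _ il] _ _] /(_ x)] := sP [:: x].
  by rewrite inE eqxx => /(_ isT)/il.
have [l [[ua ub isol _] _ _] Fl] := sP F.
have -> : map s F = map (relabel (unzip1 l) (unzip2 l)) F.
  by apply/eq_in_map => x /Fl xl; rewrite (relabel_unzip ua xl).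
have Fa : {subset F <= unzip1 l}.
  by move=> x /Fl xl; rewrite -[x]/((x, s x).1) map_f.
have sab : size (unzip1 l) = size (unzip2 l) by rewrite !size_map.
rewrite -isol ?map_relabelK //; first exact: map_relabel_uniq.
exact: map_relabel_sub.
Qed.

Lemma label_of_surj (i : seq nat) : exists x, label_of x = i.
Proof.
have [n _ E] := task_at_frequently (nil, nil, 0, i) 0.
by exists n; rewrite /label_of E.
Qed.

(** * Maximal left ideals *)

Import GRing.Theory.
Local Open Scope ring_scope.

(** The last clause is maximality: [Rt + m] is all of [R], so [t] has a left inverse modulo [m]. *)
Definition maximal_left_ideal (R : nzRingType) (m : set R) : Prop :=
  [/\ m 0, forall x y, m x -> m y -> m (x + y), forall r x, m x -> m (r * x),
      ~ m 1 & forall t, ~ m t -> exists s, m (1 - s * t)].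

Lemma maximal_left_ideal_exists (R : nzRingType) :
  exists m : set R, maximal_left_ideal m.
Proof.
(* [P] does not ask for [0], so that the union of the empty chain satisfies it; [0] is recovered
   from maximality. *)
pose P (m : set R) := [/\ forall x y, m x -> m y -> m (x + y),
  forall r x, m x -> m (r * x) & ~ m 1].
have [C CP Ctot|m [[mD mM m1] max]] := @Zorn_bigcup R P.
  split.
  - move=> x y [A CA Ax] [B CB By].
    have [AB|BA] := Ctot _ _ CA CB.
      by have [BD _ _] := CP _ CB; exists B => //; apply: BD => //; exact: AB.
    by have [AD _ _] := CP _ CA; exists A => //; apply: AD => //; exact: BA.
  - by move=> r x [A CA Ax]; have [_ AM _] := CP _ CA; exists A => //; exact: AM.
  - by move=> [A CA A1]; have [_ _] := CP _ CA.
have grow (B : set R) : (m `<=` B)%classic -> P B -> (B `<=` m)%classic.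
  move=> sub PB; apply: contrapT => nsub; exact: max B (conj sub nsub) PB.
have m0 : m 0.
  have [[x mx]|none] := pselect (exists x, m x); first by have := mM 0 _ mx; rewrite mul0r.
  apply: (grow [set 0]%classic) => // [x mx|]; first by case: none; exists x.
  by split=> [x y -> ->|r x ->|/eqP]; rewrite ?addr0 ?mulr0 //= oner_eq0.
exists m; split=> // t mt; apply: contrapT => none; apply: mt.
(* If no multiple of [t] is [1] modulo [m], then [m + Rt] is proper, hence contained in [m] by
   maximality. *)
apply: (grow [set x + s * t | x in m & s in setT]%classic) => [x mx||].
- by exists x => //; exists 0 => //; rewrite mul0r addr0.
- split.
  + move=> _ _ [x mx [s _ <-]] [y my [r _ <-]]; exists (x + y); first exact: mD.
    by exists (s + r) => //; rewrite mulrDl addrACA.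
  + move=> r _ [x mx [s _ <-]]; exists (r * x); first exact: mM.
    by exists (r * s) => //; rewrite mulrDr mulrA.
  + by move=> [x mx [s _ e]]; apply: none; exists s; rewrite -e addrK.
- by exists 0 => //; exists 1 => //; rewrite mul1r add0r.
Qed.

(** * Spans of coloured tuples in the free module *)

Section Polynomials.
Variables (R : nzRingType).
Implicit Types (p q : {poly R}) (w : seq R).

(** The polynomials serve as the free left module with basis the ['X^n], and [reindex f] is the
    linear map induced by [f] on the basis. *)
Definition reindex (f : nat -> nat) p : {poly R} :=
  \sum_(i < size p) p`_i *: 'X^(f i).

Lemma reindexE f p n : (size p <= n)%N ->
  reindex f p = \sum_(i < n) p`_i *: 'X^(f i).
Proof.
move=> pn; rewrite /reindex (big_ord_widen _ (fun i => p`_i *: 'X^(f i)) pn).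
rewrite big_mkcond; apply: eq_bigr => i _; case: ltnP => // /leq_sizeP/(_ i) ->//.
by rewrite scale0r.
Qed.

Lemma reindexD f p q : reindex f (p + q) = reindex f p + reindex f q.
Proof.
rewrite !(@reindexE _ _ (maxn (size p) (size q))) ?leq_maxl ?leq_maxr ?size_polyD //.
by rewrite -big_split; apply: eq_bigr => i _; rewrite coefD scalerDl.
Qed.

Lemma reindexZ f a p : reindex f (a *: p) = a *: reindex f p.
Proof.
rewrite !(@reindexE _ _ (size p)) ?size_scale_leq // scaler_sumr.
by apply: eq_bigr => i _; rewrite coefZ scalerA.
Qed.

Lemma reindex0 f : reindex f 0 = 0.
Proof. by rewrite /reindex size_poly0 big_ord0. Qed.

Lemma reindex_sum f (I : Type) (r : seq I) (P : pred I) (g : I -> {poly R}) :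
  reindex f (\sum_(i <- r | P i) g i) = \sum_(i <- r | P i) reindex f (g i).
Proof. by apply: big_morph; [exact: reindexD | exact: reindex0]. Qed.

Lemma reindexX f n : reindex f 'X^n = 'X^(f n).
Proof.
rewrite (@reindexE _ _ n.+1) ?size_polyXn // big_ord_recr /= coefXn eqxx scale1r.
by rewrite big1 ?add0r // => i _; rewrite coefXn ltn_eqF // scale0r.
Qed.

Lemma reindex_comp f g p : reindex g (reindex f p) = reindex (g \o f) p.
Proof.
rewrite [reindex f p]/reindex reindex_sum.
by apply: eq_bigr => i _; rewrite reindexZ reindexX.
Qed.

Lemma reindex_id p : reindex id p = p.
Proof. by rewrite /reindex -poly_def coefK. Qed.

Lemma eq_reindex f g p : f =1 g -> reindex f p = reindex g p.
Proof. by move=> fg; apply: eq_bigr => i _; rewrite fg. Qed.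

Lemma coef_reindex f p y : (reindex f p)`_y = \sum_(i < size p | f i == y) p`_i.
Proof.
rewrite coef_sum [RHS]big_mkcond; apply: eq_bigr => i _.
by rewrite coefZ coefXn eq_sym; case: eqP; rewrite ?mulr1 ?mulr0.
Qed.

Lemma coef_reindex_bij f g p y : cancel f g -> cancel g f ->
  (reindex f p)`_y = p`_(g y).
Proof.
move=> fK gK; rewrite coef_reindex.
rewrite (eq_bigl (fun i : 'I__ => val i == g y)); last first.
  by move=> i /=; rewrite (can2_eq fK gK).
case: (ltnP (g y) (size p)) => gp.
  by rewrite (big_pred1 (Ordinal gp)).
rewrite nth_default // big1 // => i /eqP iy.
by have := ltn_ord i; rewrite iy ltnNge gp.
Qed.

Definition edge_vector w F : {poly R} :=
  \sum_(i < size w) w`_i *: 'X^(nth 0%N F i).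

Lemma reindex_edge_vector f w F : size F = size w ->
  reindex f (edge_vector w F) = edge_vector w (map f F).
Proof.
move=> sF; rewrite reindex_sum; apply: eq_bigr => i _.
by rewrite reindexZ reindexX (nth_map 0%N) // sF.
Qed.

Lemma coef_edge_vector w F i : uniq F -> size F = size w -> (i < size w)%N ->
  (edge_vector w F)`_(nth 0%N F i) = w`_i.
Proof.
move=> uF sF iw; rewrite coef_sum (bigD1 (Ordinal iw)) //= coefZ coefXn eqxx mulr1.
rewrite big1 ?addr0 // => k ki; rewrite coefZ coefXn nth_uniq ?sF //.
by rewrite eq_sym -val_eqE /= in ki *; rewrite (negPf ki) mulr0.
Qed.

Lemma coef_edge_vector0 w F y : size F = size w -> y \notin F ->
  (edge_vector w F)`_y = 0.
Proof.
move=> sF yF; rewrite coef_sum big1 // => k _; rewrite coefZ coefXn.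
case: eqP => [yE|]; last by rewrite mulr0.
by rewrite yE mem_nth ?sF in yF.
Qed.

Variable m : set R.
Hypothesis mP : maximal_left_ideal m.

Let m0 : m 0. Proof. by case: mP. Qed.
Let mD x y : m x -> m y -> m (x + y). Proof. by case: mP => _ + _ _ _; exact. Qed.
Let mM r x : m x -> m (r * x). Proof. by case: mP => _ _ + _ _; exact. Qed.
Let m_inv t : ~ m t -> exists s, m (1 - s * t). Proof. by case: mP => _ _ _ _; exact. Qed.

Lemma maximal_left_idealN x : m x -> m (- x). Proof. by move=> /(mM (-1)); rewrite mulN1r. Qed.

Lemma maximal_left_idealB x y : m x -> m y -> m (x - y).
Proof. by move=> mx my; apply: mD => //; exact: maximal_left_idealN. Qed.

Lemma maximal_left_ideal_sum (I : Type) (r : seq I) (P : pred I) (g : I -> R) :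
  (forall i, P i -> m (g i)) -> m (\sum_(i <- r | P i) g i).
Proof. by move=> mg; apply: (big_ind m). Qed.

Definition small p := forall i, m p`_i.

Lemma smallD p q : small p -> small q -> small (p + q).
Proof. by move=> sp sq i; rewrite coefD; exact: mD. Qed.

Lemma smallZ a p : small p -> small (a *: p).
Proof. by move=> sp i; rewrite coefZ; exact: mM. Qed.

Lemma small0 : small 0. Proof. by move=> i; rewrite coef0. Qed.

Lemma small_monomial a n : m a -> small (a *: 'X^n).
Proof.
by move=> ma i; rewrite coefZ coefXn; case: eqP; rewrite ?mulr1 ?mulr0.
Qed.

Lemma small_reindex f p : small p -> small (reindex f p).
Proof. by move=> sp i; rewrite coef_reindex; exact: maximal_left_ideal_sum. Qed.

Lemma small_sum (I : Type) (r : seq I) (P : pred I) (g : I -> {poly R}) :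
  (forall i, P i -> small (g i)) -> small (\sum_(i <- r | P i) g i).
Proof. move=> sg; apply: (big_ind small) => //; [exact: small0|exact: smallD]. Qed.

(** As [m] is only a left ideal, right multiplication by a coefficient must be required to preserve
    it; it then induces a nonzero endomorphism of the simple module [R/m]. With a single coefficient
    an edge vector would itself be a multiple of a basis vector. *)
Definition admissible w :=
  (1 < size w)%N /\
  forall i, (i < size w)%N -> ~ m w`_i /\ forall r, m r -> m (r * w`_i).

(** Schur's lemma: right multiplication by [w_i] is a nonzero endomorphism of the simple module
    [R/m], hence injective. *)
Lemma admissible_cancel w i t : admissible w -> (i < size w)%N ->
  m (t * w`_i) -> m t.
Proof.
move=> [_ /(_ i)] wP /wP[nmw mw] mtw; apply: contrapT => /m_inv[s mst]; apply: nmw.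
rewrite -[w`_i]mul1r -(subrK (s * t) 1) mulrDl; apply: mD; first exact: mw.
by rewrite -mulrA; exact: mM.
Qed.

Lemma small_scale_edge_vector w F t : admissible w -> m t ->
  small (t *: edge_vector w F).
Proof.
move=> [_ wP] mt; rewrite /edge_vector scaler_sumr; apply: small_sum => i _.
by rewrite scalerA; apply: small_monomial; apply: (wP i _).2.
Qed.

Inductive edge_span w (E : set (seq nat)) : {poly R} -> Prop :=
| edge_span_small p : small p -> edge_span w E p
| edge_span_step p t F : edge_span w E p -> E F ->
    edge_span w E (p + t *: edge_vector w F).

Lemma edge_spanD w E p q : edge_span w E p -> edge_span w E q ->
  edge_span w E (p + q).
Proof.
move=> sp; elim=> [{}q sq|{}q t F _ IH EF]; last first.
  by rewrite addrA; exact: edge_span_step.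
elim: sp => [{}p sp|{}p t F _ IH EF]; first by apply/edge_span_small/smallD.
by rewrite addrAC; exact: edge_span_step.
Qed.

Lemma edge_spanZ w E a p : edge_span w E p -> edge_span w E (a *: p).
Proof.
elim=> [{}p sp|{}p t F _ IH EF]; first by apply/edge_span_small/smallZ.
by rewrite scalerDr scalerA; exact: edge_span_step.
Qed.

Lemma edge_span_reindex w (E E' : set (seq nat)) f p :
  (forall F, E F -> size F = size w /\ E' (map f F)) ->
  edge_span w E p -> edge_span w E' (reindex f p).
Proof.
move=> EE'; elim=> [{}p sp|{}p t F _ IH EF].
  by apply/edge_span_small/small_reindex.
have [sF E'F] := EE' F EF.
by rewrite reindexD reindexZ reindex_edge_vector //; exact: edge_span_step.
Qed.

Lemma sub_edge_span w (E E' : set (seq nat)) p : (E `<=` E')%classic ->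
  edge_span w E p -> edge_span w E' p.
Proof.
move=> EE'; elim=> [{}p sp|{}p t F _ IH EF]; first exact: edge_span_small.
by apply: edge_span_step => //; exact: EE'.
Qed.

Definition edges (j : seq nat) w (A : seq nat) : set (seq nat) :=
  [set F | [/\ uniq F, size F = size w, color F = j & {subset F <= A}]]%classic.

Lemma edge_span_supp j w A p y : edge_span w (edges j w A) p -> y \notin A -> m p`_y.
Proof.
move=> sp yA; elim: sp => [{}p sp|{}p t F _ IH [_ sF _ FA]]; first exact: sp.
rewrite coefD coefZ coef_edge_vector0 ?mulr0 ?addr0 //.
by apply: contraNN yA; exact: FA.
Qed.

(** Separation leaves at most one tuple of colour [j] through [x], so its occurrences merge into one
    term. *)
Lemma edge_span_top j w A x p : separated color A x ->
  edge_span w (edges j w (x :: A)) p ->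
  exists2 v, edge_span w (edges j w A) v &
    p = v \/ exists t F, [/\ edges j w (x :: A) F, x \in F & p = v + t *: edge_vector w F].
Proof.
move=> sA; elim=> [{}p sp|{}p t F _ [v sv IH] EF].
  by exists p; [exact: edge_span_small|left].
have [uF sF cF FA] := EF.
have [xF|xF] := boolP (x \in F).
  exists v => //; right; case: IH => [->|[u [G [[uG sG cG GA] xG ->]]]].
    by exists t, F.
  exists (u + t), F; split=> //.
  by rewrite (sA G F) ?cF // -addrA -scalerDl.
exists (v + t *: edge_vector w F).
  apply: edge_span_step => //; split => // z zF; have := FA z zF.
  by rewrite inE => /orP[/eqP zx|//]; rewrite -zx zF in xF.
case: IH => [->|[u [G [EG xG ->]]]]; first by left.
by right; exists u, G; split => //; rewrite addrAC.
Qed.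

Lemma edge_vector_coef_in w F x : uniq F -> size F = size w -> x \in F ->
  exists2 i, (i < size w)%N & (edge_vector w F)`_x = w`_i.
Proof.
move=> uF sF xF; have iw : (index x F < size w)%N by rewrite -sF index_mem.
by exists (index x F) => //; rewrite -{1}(nth_index 0%N xF) coef_edge_vector.
Qed.

(** The newest point [x] is met by at most one tuple, with coefficient [t w_i] there. As the
    coefficient of [p] at [x] is in [m], cancellation puts [t] in [m] and the whole term is
    small. *)
Lemma edge_span_restrict j w b B p : admissible w -> grows color b B ->
  edge_span w (edges j w B) p -> (forall z, z \notin b -> m p`_z) ->
  edge_span w (edges j w b) p.
Proof.
move=> wP gB; elim: gB p => // {}B x gB IH xB sB p /(edge_span_top sB) [v sv].
case=> [->|[t [F [[uF sF _ _] xF ->]]]] supp; first exact: IH.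
have [i iw Fi] := edge_vector_coef_in uF sF xF.
have mt : m t.
  have xb : x \notin b by apply: contraNN xB => /(grows_sub gB).
  apply: (admissible_cancel wP iw); have := supp x xb.
  rewrite coefD coefZ Fi => /maximal_left_idealB /(_ (edge_span_supp sv xB)).
  by rewrite addrAC subrr add0r.
apply: edge_spanD; last by apply/edge_span_small/small_scale_edge_vector.
apply: IH => // z zb; have := supp z zb.
move/maximal_left_idealB/(_ (small_scale_edge_vector F wP mt z)).
by rewrite coefD addrK.
Qed.

Lemma small_off_monomial p x : (forall y, y != x -> m p`_y) -> small (p - p`_x *: 'X^x).
Proof.
move=> px y; rewrite coefB coefZ coefXn; case: eqP => [->|/eqP yx].
  by rewrite mulr1 subrr.
by rewrite mulr0 subr0; exact: px.
Qed.

(* A tuple [F] with greatest point [n] either has a colour not used below [n], or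
   copies the colour of a tuple of older points, in which case relabelling
   carries the combination down to those points. *)
Lemma edge_span_no_monomial n j w p x : admissible w ->
  edge_span w (edges j w (iota 0 n)) p -> (forall y, y != x -> m p`_y) -> m p`_x.
Proof.
move=> wP; elim: n p x => [|n IH] p x sp px; first exact: edge_span_supp sp _.
have mem_top z : (z \in n :: iota 0 n) = (z \in iota 0 n.+1).
  by rewrite inE !mem_iota /= ?add0n ltnS (leq_eqVlt z).
have {}sp : edge_span w (edges j w (n :: iota 0 n)) p.
  by apply: sub_edge_span sp => F [uF sF cF Fn]; split=> // z /Fn; rewrite mem_top.
have [v sv [pv|[t [F [[uF sF cF Fn] nF pE]]]]] := edge_span_top (@color_separated n) sp.
  by apply: IH px; rewrite pv.
have vn : m v`_n by apply: (edge_span_supp sv); rewrite mem_iota ltnn.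
have small_t : m t -> m p`_x.
  move=> /(small_scale_edge_vector F wP) st.
  rewrite pE coefD; apply: mD; last exact: st.
  apply: (IH v) => // y /px /maximal_left_idealB/(_ (st y)); by rewrite pE coefD addrK.
have [xn|xn] := eqVneq x n; last first.
  have [i iw Fi] := edge_vector_coef_in uF sF nF.
  apply/small_t/(admissible_cancel wP iw); rewrite eq_sym in xn.
  have := maximal_left_idealB (px n xn) vn; by rewrite pE coefD coefZ Fi addrAC subrr add0r.
have Fn' : all (ltn^~ n.+1) F by apply: iota_ltn => z /Fn; rewrite mem_top.
have [Ffresh|[a [b [y [i [E vld Fb cFE]]]]]] := color_fresh_or_copy nF Fn'.
  (* The fresh colour contains [n], so no tuple below [n] has it and [v] is small; a point of [F]
     other than [n] then puts [t] in [m]. *)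
  have sv0 : small v.
    case: sv => // q u G _ [_ _ cG /iota_ltn/color_lt/allP/(_ n)].
    by rewrite cG -cF Ffresh /= ltnn => /(_ nF).
  have [w1 _] := wP; have sF1 : (1 < size F)%N by rewrite sF.
  have [i iw iF] : exists2 i, (i < size w)%N & nth 0%N F i != n.
    have [F0|] := eqVneq (nth 0%N F 0) n; last by exists 0%N => //; exact: ltnW.
    by exists 1%N => //; rewrite -F0 nth_uniq // ltnW.
  apply/small_t/(admissible_cancel wP iw); rewrite -xn in iF.
  rewrite -(coef_edge_vector uF sF iw) -coefZ.
  have := maximal_left_idealB (px _ iF) (sv0 (nth 0%N F i)).
  by rewrite pE coefD addrAC subrr add0r; apply.
have [[uya ub sab] yan bn [isoab sepa [B gB Bn]]] := vld.
have snb : size (n :: b) = size (y :: a) by rewrite /= sab.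
set f := relabel (n :: b) (y :: a) in cFE.
have fn : f n = y by exact: relabel_head.
have ltf G : {subset G <= n :: b} -> {subset map f G <= iota 0 n}.
  move=> Gb z /(map_relabel_sub snb Gb) zya.
  by rewrite mem_iota add0n; exact: (allP yan).
have nb : n \notin b by apply/negP => /(allP bn) /=; rewrite ltnn.
(* Off [n :: b] neither [p] nor the edge vector of [F] has a coefficient outside [m], so neither
   does [v], and strength of [b] applies. *)
have spb : edge_span w (edges j w b) v.
  apply: (edge_span_restrict wP gB).
    apply: sub_edge_span sv => G [uG sG cG Gn]; split => // z /Gn; by rewrite Bn.
  move=> z zb; have [->//|zn] := eqVneq z n.
  have zF : z \notin F.
    by apply: contraNN zb => /Fb; rewrite inE (negPf zn).
  rewrite -xn in zn; have := px z zn.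
  by rewrite pE coefD coefZ coef_edge_vector0 // mulr0 addr0.
have fp : edge_span w (edges j w (iota 0 n)) (reindex f p).
  rewrite pE reindexD reindexZ reindex_edge_vector //.
  apply: edge_span_step; last first.
    split; [exact: map_relabel_uniq | by rewrite size_map | by rewrite -cFE | exact: ltf].
  apply: edge_span_reindex spb => G [uG sG cG Gb]; split=> //.
  have Gnb : {subset G <= n :: b} by move=> z /Gb zb; rewrite inE zb orbT.
  split; [exact: map_relabel_uniq | by rewrite size_map | | exact: ltf].
  rewrite -cG -(isoab G uG Gb); congr color; apply/eq_in_map => z zG.
  by rewrite /f relabel_behead //; apply: contraNneq nb => <-; exact: Gb.
(* Modulo [m], [p] is a multiple of ['X^n], so its image is the same multiple of ['X^y], to which
   the induction hypothesis applies. *)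
rewrite xn in px *; have := small_reindex f (small_off_monomial px).
rewrite reindexD -scaleN1r !reindexZ scaleN1r reindexX fn => sm.
have fpy : m (reindex f p)`_y.
  apply: (IH _ _ fp) => z zy; have := sm z.
  by rewrite coefB coefZ coefXn (negPf zy) mulr0 subr0.
have := maximal_left_idealB fpy (sm y).
by rewrite coefB coefZ coefXn eqxx mulr1 opprB addrCA subrr addr0.
Qed.

End Polynomials.

(** * Encoding a structure *)

Section Labels.
Variable L : language.
Implicit Types (M N : structure L) (i : seq nat).

Definition label_query : countType := (nat + (rel_sym L + fun_sym L))%type.

(** Functions are queried through their graphs, value first; the length queries force induced maps
    of labels to preserve length. *)
Definition label_holds M (s : label_query) i : bool :=
  match s with
  | inl k => size i == k
  | inr (inl r) =>
    if (insub i : option ((rel_arity r).-tuple nat)) is Some t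
    then rel_interp M t else false
  | inr (inr g) =>
    if i is b :: j then
      if (insub j : option ((fun_arity g).-tuple nat)) is Some t
      then fun_interp M t == b else false
    else false
  end.

Lemma insub_map_tuple k (h : nat -> nat) i :
  (insub (map h i) : option (k.-tuple nat)) = omap (map_tuple h) (insub i).
Proof.
case: insubP => [t /eqP it tE|]; last first.
  rewrite size_map => ki; by rewrite insubN.
have ki : size i == k by rewrite -(size_map h) it.
rewrite (insubT (fun s : seq nat => size s == k) ki) /=.
by congr Some; apply: val_inj; rewrite tE.
Qed.

Lemma iso_label_holdsP M N : iso M N <-> exists2 h : nat -> nat, bijective h &
  forall s i, label_holds N s (map h i) = label_holds M s i.
Proof.
split=> [[h [bh hr hf]]|[h bh hl]]; exists h => //.
  case=> [k|[r|g]] i /=; first by rewrite size_map.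
    by rewrite insub_map_tuple; case: insub => //= t; rewrite hr.
  case: i => //= b j; rewrite insub_map_tuple; case: insub => //= t.
  by rewrite hf (inj_eq (bij_inj bh)).
split=> // [r t|g t].
  have := hl (inr (inl r)) t.
  by rewrite /= insub_map_tuple valK.
(* Querying the graph at the true value turns preservation of graphs into equality of values. *)
have := hl (inr (inr g)) (fun_interp M t :: t).
by rewrite /= insub_map_tuple valK /= eqxx => /eqP.
Qed.

(** A query reads at most one coordinate of a product of discrete spaces. *)
Lemma label_holds_near M s i :
  \forall M' \near M, label_holds M' s i = label_holds M s i.
Proof.
have const (P : structure L -> Prop) : (forall M', P M') -> \forall M' \near M, P M'.
  by move=> MP; apply: (@filterE _ (nbhs M)).
case: s => [k|[r|g]] /=; first exact: const.
  case: insub => [t|]; last exact: const.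
  have c : continuous (fun M' : structure L => rel_interp M' t : bool).
    move=> M'; apply: (@continuous_comp _ _ _ (fun M' : structure L => M'.1 r)
      (fun f : {ptws _ -> _} => f t)); last exact: proj_continuous.
    apply: (@continuous_comp _ _ _ fst (fun f : prod_topology _ => f r)).
      exact: cvg_fst.
    exact: (@proj_continuous (rel_sym L)).
  exact: (c M [set rel_interp M t]%classic (discrete_set1 _)).
case: i => [|b j]; first exact: const.
case: insub => [t|]; last exact: const.
have c : continuous (fun M' : structure L => fun_interp M' t : nat).
  move=> M'; apply: (@continuous_comp _ _ _ (fun M' : structure L => M'.2 g)
    (fun f : {ptws _ -> _} => f t)); last exact: proj_continuous.
  apply: (@continuous_comp _ _ _ snd (fun f : prod_topology _ => f g)).
    exact: cvg_snd.
  exact: (@proj_continuous (fun_sym L)).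
have : \forall M' \near M, fun_interp M' t = fun_interp M t.
  exact: (c M [set fun_interp M t]%classic (discrete_set1 _)).
by apply: filterS => M' ->.
Qed.

End Labels.

(** * Continuity, Borel maps and a countable carrier *)

Lemma continuous_to_prod (X : topologicalType) (I : Type)
    (T : I -> topologicalType) (f : X -> prod_topology T) :
  (forall i, continuous (fun x => f x i)) -> continuous f.
Proof.
move=> cf x; apply/cvg_sup => i; move: x.
apply/(@continuousP _ (initial_topology (fun g : prod_topology T => g i))).
by move=> A [B oB <-]; move/continuousP: (cf i) => /(_ B oB).
Qed.

Lemma near_eq_continuous (X : topologicalType) (Y : topologicalType) (f : X -> Y) :
  (forall x, \forall x' \near x, f x' = f x) -> continuous f.
Proof.
by move=> cf x A /nbhs_singleton Ax; apply: filterS (cf x) => x' /= ->.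
Qed.

Lemma continuous_borel_map_on (T U : topologicalType) (D : set T) (f : T -> U) :
  continuous f -> borel_map_on D f.
Proof.
move=> /continuousP cf B bB; exists (f @^-1` B)%classic => //.
move: B bB; apply: smallest_sub; last first.
  by move=> A oA; apply: sub_gen_smallest; exact: cf.
have [b0 bC bU] := smallest_sigma_algebra [set: T]%classic (@open T).
split => [|A bA|A bA] /=.
- by rewrite preimage_set0.
- by rewrite setTD preimage_setC -setTD; exact: bC.
- by rewrite preimage_bigcup; exact: bU.
Qed.

(** The powers of ['X] make the countable module infinite, so it can be carried by the naturals. *)
Lemma poly_enumeration (R : countNzRingType) :
  exists dec : nat -> {poly R}, bijective dec.
Proof.
have inf : ~ finite_set [set: {poly R}]%classic.
  move=> fin; suff : finite_set [set: nat]%classic by exact: infinite_nat.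
  have inj : {in [set: nat]%classic &, injective (fun n => 'X^n : {poly R})}.
    by move=> n k _ _ /(congr1 (fun p : {poly R} => size p)); rewrite !size_polyXn => -[].
  by rewrite -(eq_finite_set (inj_card_eq inj)); apply: sub_finite_set fin.
have /card_set_bijP[f] := eq_card_nat (countableP [set: {poly R}]%classic) inf.
by rewrite setTT_bijective => -[g fK gK]; exists g; exists f.
Qed.

(* Entries are shifted by one so that [0] stands for a missing entry: this makes
   the key equivariant under permutations of the entries. *)
Definition key (k : nat) (i : seq nat) : nat :=
  nth 0%N (map S i) (if size i == 1%N then 0%N else k).

Lemma key_map (h : nat -> nat) k i :
  key k (map h i) = (if key k i is a.+1 then (h a).+1 else 0%N).
Proof.
rewrite /key size_map; set k' := if _ then _ else _.
case: (ltnP k' (size i)) => ki; last by rewrite !nth_default ?size_map.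
by rewrite !(nth_map 0%N) ?size_map.
Qed.

Lemma key_nth k i : (k < size i)%N -> key k i = (nth 0%N i k).+1.
Proof.
rewrite /key; case: eqP => [i1|_] ki; last by rewrite (nth_map 0%N).
have k0 : k = 0%N by apply/eqP; rewrite -leqn0 -ltnS -[1%N]i1.
by rewrite k0 (nth_map 0%N) // i1.
Qed.

(** * Tags on the free module *)

Section Tags.
Variables (R : countNzRingType) (m : set R) (L : language).
Hypothesis mP : maximal_left_ideal m.
Implicit Types (M N : structure L) (v : {poly R}).

Definition tag : countType :=
  ((seq nat * seq R) + (nat + label_query L))%type.

Definition colored (j : seq nat) (w : seq R) : set (seq nat) :=
  [set F | [/\ uniq F, size F = size w & color F = j]]%classic.

(* The keys make the permutation of the basis act entrywise on labels; the last
   tags record the structure. *)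
Definition tag_set M (q : tag) v : Prop :=
  match q with
  | inl (j, w) => edge_span m w (colored j w) v
  | inr (inl k) => small m (reindex (key k \o label_of) v)
  | inr (inr s) => forall x, ~ m v`_x -> label_holds M s (label_of x)
  end.

Lemma tag_set0 M q : tag_set M q 0.
Proof.
case: q => [[j w]|[k|s]] /=.
- by apply: edge_span_small; exact: small0.
- by rewrite reindex0; exact: small0.
- by move=> x []; rewrite coef0; case: mP.
Qed.

Lemma tag_setD M q u v : tag_set M q u -> tag_set M q v -> tag_set M q (u + v).
Proof.
case: q => [[j w]|[k|s]] /=.
- exact: edge_spanD.
- by rewrite reindexD; exact: smallD.
- move=> su sv x; rewrite coefD => uv.
  have [mu|/su//] := pselect (m u`_x); apply: sv => mv; apply: uv.
  by case: mP => _ mD _ _ _; exact: mD.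
Qed.

Lemma tag_setZ M q a v : tag_set M q v -> tag_set M q (a *: v).
Proof.
case: q => [[j w]|[k|s]] /=.
- exact: edge_spanZ.
- by rewrite reindexZ; exact: smallZ.
- move=> sv x; rewrite coefZ => av; apply: sv => mv; apply: av.
  by case: mP => _ _ mM _ _; exact: mM.
Qed.

Lemma tag_set_reindex M N (h s s' : nat -> nat) q v :
  cancel s s' -> cancel s' s ->
  (forall F, uniq F -> color (map s F) = color F) ->
  (forall x, label_of (s x) = map h (label_of x)) ->
  (forall l i, label_holds N l (map h i) = label_holds M l i) ->
  tag_set M q v -> tag_set N q (reindex s v).
Proof.
move=> sK s'K sc si hl; case: q => [[j w]|[k|l]] /=.
- apply: edge_span_reindex => // F [uF sF cF]; split=> //.
  by split; rewrite ?size_map ?sc // map_inj_uniq //; exact: can_inj sK.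
- rewrite reindex_comp => sv.
  rewrite (@eq_reindex _ _ ((fun a => if a is b.+1 then (h b).+1 else 0%N)
    \o (key k \o label_of))); last by move=> x /=; rewrite si key_map.
  by rewrite -reindex_comp; exact: small_reindex.
- move=> sv x; rewrite (coef_reindex_bij _ _ sK s'K) => /sv.
  by rewrite -(hl l) -si s'K.
Qed.

(** A combination involves finitely many tuples, so the results on initial segments apply to it. *)
Lemma colored_edges j w v : edge_span m w (colored j w) v ->
  exists n, edge_span m w (edges j w (iota 0 n)) v.
Proof.
elim=> [{}v sv|{}v t F _ [n IH] [uF sF cF]]; first by exists 0%N; exact: edge_span_small.
exists (maxn n (\max_(x <- F) x).+1); apply: edge_span_step.
  apply: sub_edge_span IH => G [uG sG cG Gn]; split=> // z /Gn.
  by rewrite !mem_iota /= !add0n leq_max => ->.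
split=> // z zF; rewrite mem_iota /= add0n leq_max; apply/orP; right.
by rewrite ltnS (big_rem z) //= leq_maxl.
Qed.

(** Edge vectors without coefficients vanish, so the tags with empty [w] name [mV] itself. *)
Lemma edge_span_nil (E : set (seq nat)) v : edge_span m [::] E v <-> small m v.
Proof.
split=> [|sv]; last exact: edge_span_small.
by elim=> // {}v t F _ sv _; rewrite /edge_vector big_ord0 scaler0 addr0.
Qed.

(** * Isomorphisms respecting the tags *)

Definition tag_iso M N (f g : {poly R} -> {poly R}) : Prop :=
  [/\ cancel f g, forall u v, f (u + v) = f u + f v,
      forall a v, f (a *: v) = a *: f v
    & forall q v, tag_set M q v <-> tag_set N q (f v)].

Definition leads_to (f : {poly R} -> {poly R}) (x y : nat) : Prop :=
  ~ m (f 'X^x)`_y /\ forall z, z != y -> m (f 'X^x)`_z.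

Section TagIso.
Variables (M N : structure L) (f g : {poly R} -> {poly R}).
Hypothesis fP : tag_iso M N f g.

Let m0 : m 0. Proof. by case: mP. Qed.
Let mD x y : m x -> m y -> m (x + y). Proof. by case: mP => _ + _ _ _; exact. Qed.
Let m1 : ~ m 1. Proof. by case: mP. Qed.

Lemma tag_iso_small v : small m v <-> small m (f v).
Proof.
case: fP => _ _ _ /(_ (inl (nil, nil)) v) /=.
by rewrite !edge_span_nil.
Qed.

Lemma monomial_not_small x : ~ small m ('X^x : {poly R}).
Proof. by move=> /(_ x); rewrite coefXn eqxx. Qed.

(* If [f 'X^x] had two coefficients outside [m], then it would lie in the tag
   of the tuple of their positions, which contains no monomial. *)
Lemma tag_iso_leads_to x : exists y, leads_to f x y.
Proof.
have [_ _ fZ ftag] := fP; set v := f 'X^x.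
pose F := [seq z <- iota 0 (size v) | ~~ `[< m v`_z >]].
have uF : uniq F by rewrite filter_uniq ?iota_uniq.
have memF z : (z \in F) = ~~ `[< m v`_z >].
  rewrite mem_filter mem_iota /= add0n; case: ltnP; rewrite ?andbT ?andbF //.
  by move=> vz; rewrite nth_default //; symmetry; apply/negbTE; rewrite negbK; apply/asboolP.
have inF z : z \in F -> ~ m v`_z by rewrite memF => /negP nm mz; apply/nm/asboolP.
have notinF z : z \notin F -> m v`_z by rewrite memF negbK => /asboolP.
have [F2|F1] := ltnP 1 (size F).
  pose w := [seq v`_z | z <- F]; exfalso.
  have sFw : size F = size w by rewrite size_map.
  have wi i : (i < size w)%N -> w`_i = v`_(nth 0%N F i).
    by rewrite -sFw => iF; rewrite (nth_map 0%N).
  have wP : admissible m w.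
    split=> [|i iw]; first by rewrite -sFw.
    rewrite wi //; split; first by apply: inF; rewrite mem_nth ?sFw.
    (* [f] preserves [mV], which contains [r *: 'X^x] for [r] in [m]; this makes the coefficients of
       the image admissible. *)
    move=> r mr; have /tag_iso_small : small m (r *: ('X^x : {poly R})).
      exact: small_monomial.
    by rewrite fZ => /(_ (nth 0%N F i)); rewrite coefZ.
  have vw : small m (v - 1 *: edge_vector w F).
    move=> z; rewrite scale1r coefB; have [zF|zF] := boolP (z \in F).
      have iw : (index z F < size w)%N by rewrite -sFw index_mem.
      by rewrite -{2}(nth_index 0%N zF) coef_edge_vector // wi // nth_index // subrr.
    by rewrite coef_edge_vector0 // subr0; exact: notinF.
  have : tag_set N (inl (color F, w)) v.
    rewrite /= -(subrK (1 *: edge_vector w F) v).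
    by apply: edge_span_step; first exact: edge_span_small.
  move=> /ftag/colored_edges[n spX].
  have := edge_span_no_monomial (x := x) mP wP spX.
  rewrite coefXn eqxx; apply/not_implyP; split => // y yx.
  by rewrite coefXn (negPf yx).
case FE : F F1 memF inF notinF => [|y [|//]] _ memF inF notinF.
  by case: (monomial_not_small (x := x)); apply/tag_iso_small => z; exact: notinF.
exists y; split=> [|z zy]; first by apply: inF; rewrite inE.
by apply: notinF; rewrite inE.
Qed.

Lemma leads_to_small x y : leads_to f x y ->
  small m (f 'X^x - (f 'X^x)`_y *: 'X^y).
Proof. by move=> [_ fx]; exact: small_off_monomial. Qed.

(** Equal keys place ['X^x - 'X^y] in the key tag. If the keys of the images differed, the
    coefficient of [f 'X^x] at [x'] would survive alone and so lie in [m]. *)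
Lemma leads_to_key x y x' y' k : leads_to f x x' -> leads_to f y y' ->
  key k (label_of x) = key k (label_of y) ->
  key k (label_of x') = key k (label_of y').
Proof.
move=> fx fy kxy; apply: contrapT => /eqP kxy'; have [_ fD fZ ftag] := fP.
have : tag_set M (inr (inl k)) ('X^x - 'X^y).
  rewrite /= -scaleN1r reindexD reindexZ !reindexX /= kxy scaleN1r subrr.
  exact: small0.
move=> /ftag /=; rewrite -scaleN1r fD fZ reindexD reindexZ scaleN1r.
set K := key k \o label_of; move=> /(_ (K x')).
have := small_reindex mP K (leads_to_small fx) (K x').
have := small_reindex mP K (leads_to_small fy) (K x').
case: fx => na _; set a := (f 'X^x)`_x' in na *.
rewrite -!scaleN1r !(reindexD, reindexZ) !reindexX !scaleN1r.
rewrite !(coefB, coefZ, coefXn) eqxx (negPf kxy') mulr1 mulr0 subr0.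
set A := (reindex K (f 'X^x))`_ _; set B := (reindex K (f 'X^y))`_ _.
move=> small_b small_a small_ab; apply: na; rewrite -(subKr A a).
by apply: maximal_left_idealB => //; rewrite -(subrK B A); exact: mD.
Qed.

(** A basis vector lies in the tag of a query exactly when its label satisfies it. *)
Lemma tag_iso_label x y s : leads_to f x y ->
  label_holds N s (label_of y) = label_holds M s (label_of x).
Proof.
move=> [nfy fz]; have [_ _ _ /(_ (inr (inr s)) 'X^x) /= ftag] := fP.
apply/idP/idP => [hy|hx].
  apply: (ftag.2 _ x); last by rewrite coefXn eqxx.
  move=> z nz; suff -> : z = y by [].
  by apply: contrapT => /eqP /fz.
apply: (ftag.1 _ y) => // z; rewrite coefXn; case: eqP => [->//|_].
by move=> /(_ m0).
Qed.

(** The map [h] is read off from points with labels of length one; keys compare the entries of other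
    labels with these. *)
Lemma tag_iso_action : exists s h : nat -> nat,
  (forall x, leads_to f x (s x)) /\ forall x, label_of (s x) = map h (label_of x).
Proof.
have /choice[s sP] := tag_iso_leads_to; have /choice[e eP] a := label_of_surj [:: a].
pose h a := nth 0%N (label_of (s (e a))) 0; exists s, h; split=> // x.
have same_size y : size (label_of (s y)) = size (label_of y).
  by have /= := tag_iso_label (inl (size (label_of y))) (sP y); rewrite eqxx => /eqP.
apply: (@eq_from_nth _ 0%N) => [|k]; first by rewrite size_map same_size.
rewrite same_size => kx; rewrite (nth_map 0%N) //; set a := nth 0%N (label_of x) k.
(* A label of length one has the same key for every [k], so it can be compared with any entry of any
   label. *)
have kxa : key k (label_of x) = key k (label_of (e a)) by rewrite eP key_nth.
have := leads_to_key (sP x) (sP (e a)) kxa.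
by rewrite key_nth ?same_size // /key same_size eP /= (nth_map 0%N) ?same_size ?eP // => -[].
Qed.

End TagIso.

Lemma tag_iso_sym M N f g : cancel g f -> tag_iso M N f g -> tag_iso N M g f.
Proof.
move=> gK [fK fD fZ ftag]; split=> // [u v|a v|q v].
- by apply: (can_inj fK); rewrite fD !gK.
- by apply: (can_inj fK); rewrite fZ !gK.
- by rewrite (ftag q (g v)) gK.
Qed.

(** Modulo [mV], ['X^x] is a multiple of [g 'X^y]; if [z] differed from [x], its coefficient [1] at
    [x] would lie in [m]. *)
Lemma leads_to_inverse M N f g x y z : cancel g f -> tag_iso M N f g ->
  leads_to f x y -> leads_to g y z -> z = x.
Proof.
move=> gK fP fx [_ gy]; have [_ gD gZ gtag] := tag_iso_sym gK fP.
have [_ mD mM m1 _] := mP; have [fK _ _ _] := fP.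
apply: contrapT => /eqP; rewrite eq_sym => xz; apply: m1.
have := (tag_iso_small (tag_iso_sym gK fP) _).1 (leads_to_small fx) x.
set a := (f 'X^x)`_y; rewrite -scaleN1r gD !gZ scaleN1r fK.
rewrite coefB coefZ coefXn eqxx => /mD/(_ (mM a _ (gy x xz))).
by rewrite subrK.
Qed.

Lemma tag_iso_iso M N f g : cancel g f -> tag_iso M N f g -> iso M N.
Proof.
move=> gK fP; have gP := tag_iso_sym gK fP.
have [s [h [fs sh]]] := tag_iso_action fP.
have [s' [h' [gs sh']]] := tag_iso_action gP.
have sK x : s' (s x) = x by exact: (leads_to_inverse gK fP (fs x) (gs (s x))).
have s'K x : s (s' x) = x.
  by have [fK _ _ _] := fP; exact: (leads_to_inverse fK gP (gs x) (fs (s' x))).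
apply/iso_label_holdsP; exists h.
  exists h' => a; have [x xa] := label_of_surj [:: a].
    by have := sh' (s x); rewrite sK sh xa => -[].
  by have := sh (s' x); rewrite s'K sh' xa => -[].
move=> l i; have [x <-] := label_of_surj i.
by rewrite -sh; exact: (tag_iso_label fP).
Qed.

Lemma iso_tag_iso M N : iso M N -> exists f g, cancel g f /\ tag_iso M N f g.
Proof.
move=> /iso_label_holdsP[h bh hl]; have [s [[s' sK s'K] sc sh]] := lift_permutation bh.
have [h' hK h'K] := bh.
have rK t t' : cancel t t' -> cancel (@reindex R t) (@reindex R t').
  by move=> tK v; rewrite reindex_comp (eq_reindex _ tK) reindex_id.
exists (reindex s), (reindex s'); split; first exact: rK.
split; [exact: rK | exact: reindexD | exact: reindexZ | move=> q v; split].
  exact: (tag_set_reindex sK s'K sc sh hl).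
move=> /(tag_set_reindex (h := h') (N := M) s'K sK); rewrite rK //; apply.
- move=> F uF; rewrite -sc; last by rewrite map_inj_uniq //; exact: can_inj s'K.
  by rewrite -map_comp (eq_map s'K) map_id.
- by move=> x; rewrite -{2}(s'K x) sh -map_comp (eq_map hK) map_id.
- by move=> l i; rewrite -(hl l) -map_comp (eq_map h'K) map_id.
Qed.

(** * The tagged module on the naturals *)

Variables (dec : nat -> {poly R}) (enc : {poly R} -> nat).
Hypotheses (decK : cancel dec enc) (encK : cancel enc dec).

Definition module_op (s : module_sym R) (vs : seq {poly R}) : {poly R} :=
  match s with
  | Zero => 0
  | Add => nth 0 vs 0 + nth 0 vs 1
  | Scale a => a *: nth 0 vs 0
  end.

(** A number coding no tag is interpreted by the whole module. *)
Definition tagged_by M (n : nat) v : Prop :=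
  if unpickle n is Some q then tag_set M q v else True.

Definition encode M : structure (tagged_module_language R) :=
  (fun (n : rel_sym (tagged_module_language R)) (t : (rel_arity n).-tuple nat) =>
     `[< tagged_by M n (dec (nth 0%N t 0)) >],
   fun (s : fun_sym (tagged_module_language R)) (t : (fun_arity s).-tuple nat) =>
     enc (module_op s (map dec t))).

Lemma encode_tagged M : tagged_modules (encode M).
Proof.
have zE : mod_zero (encode M) = enc 0 by [].
have aE x y : mod_add (encode M) x y = enc (dec x + dec y) by [].
have sE a x : mod_scale (encode M) a x = enc (a *: dec x) by [].
split.
  split=> [|a b x|x|a x y|a b x]; rewrite ?(aE, sE) ?encK.
  - split=> [x y z|x y|x|x]; rewrite ?zE ?aE ?encK ?addrA ?add0r ?decK //.
    + by rewrite addrC.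
    + by exists (enc (- dec x)); rewrite aE encK addNr.
  - by rewrite scalerA.
  - by rewrite scale1r decK.
  - by rewrite scalerDr.
  - by rewrite scalerDl.
move=> n; have tE x : mod_tag (encode M) n x = `[< tagged_by M n (dec x) >] by [].
split=> [|x y|a x]; rewrite !tE ?zE ?aE ?sE ?encK /tagged_by; case: (unpickle n) => [q|].
- by apply/asboolP; exact: tag_set0.
- by apply/asboolP.
- by move=> /asboolP xq /asboolP yq; apply/asboolP; exact: tag_setD.
- by move=> _ _; apply/asboolP.
- by move=> /asboolP xq; apply/asboolP; exact: tag_setZ.
- by move=> _; apply/asboolP.
Qed.

Lemma encode_continuous : continuous encode.
Proof.
have c1 : continuous (fun M => (encode M).1); last first.
  (* The module operations do not depend on [M]; only the tags vary. *)
  by move=> M; apply: (cvg_pair (c1 M) (cvg_cst (encode M).2)).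
apply: continuous_to_prod => n; apply: continuous_to_prod => t.
apply: near_eq_continuous => M; rewrite /encode /= /tagged_by; set v := dec _.
case: (unpickle n) => [[jw|[k|s]]|]; try by apply: (@filterE _ (nbhs M)).
(* Coefficients beyond the size of [v] vanish and so lie in [m]; membership in a tag recording the
   structure thus depends on finitely many queries. *)
have : \forall M' \near M, forall x : 'I_(size v),
    label_holds M' s (label_of x) = label_holds M s (label_of x).
  apply: (@filter_forall _ _ (fun (x : 'I_(size v)) M' =>
    label_holds M' s (label_of x) = label_holds M s (label_of x)) (nbhs M)) => x.
  exact: label_holds_near.
apply: filterS => M' M'M; apply: asbool_equiv_eq => /=.
have m0 : m 0 by case: mP.
by split=> sv x nx; have xv : (x < size v)%N by
  [rewrite ltnNge; apply/negP => vx; apply: nx; rewrite nth_default];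
  have := M'M (Ordinal xv) => /= e; move: (sv x nx); rewrite e.
Qed.

Lemma encode_iso M N : iso (encode M) (encode N) <-> iso M N.
Proof.
split=> [[h [[h' hK h'K] hr hf]]|].
  have [fK gK] : cancel (dec \o h \o enc) (dec \o h' \o enc) /\
      cancel (dec \o h' \o enc) (dec \o h \o enc).
    by split=> v /=; rewrite decK ?hK ?h'K encK.
  apply: (tag_iso_iso (f := dec \o h \o enc) gK); split=> // [u v|a v|q v] /=.
  - have := hf Add [tuple enc u; enc v]; rewrite /fun_interp /= !encK => e.
    by rewrite -e encK.
  - by have := hf (Scale a) [tuple enc v]; rewrite /fun_interp /= !encK => <-; rewrite encK.
  - have := hr (pickle q) [tuple enc v].
    rewrite /rel_interp /= /tagged_by pickleK encK => e.
    by split=> /asboolP; [rewrite -e|rewrite e] => /asboolP.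
move=> /iso_tag_iso[f [g [gK [fK fD fZ ftag]]]].
exists (enc \o f \o dec); split.
- by exists (enc \o g \o dec) => x /=; rewrite encK ?fK ?gK decK.
- move=> n t; rewrite /rel_interp /= (nth_map 0%N) ?size_tuple //= encK /tagged_by.
  case: (unpickle n) => [q|//]; apply: asbool_equiv_eq.
  exact: iff_sym (ftag _ _).
- have f0 : f 0 = 0 by have := fZ 0 0; rewrite !scale0r.
  move=> s t; rewrite /fun_interp /= encK; congr enc.
  have -> : map dec (map (enc \o f \o dec) t) = map f (map dec t).
    by rewrite -!map_comp; apply: eq_map => x /=; rewrite encK.
  have st : size (map dec t) = module_sym_arity s by rewrite size_map size_tuple.
  move: (map dec t) st => vs.
  by case: s t => [||a] _ /= svs; rewrite ?f0 ?fD ?fZ // !(nth_map 0) ?svs.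
Qed.

End Tags.

Theorem theorem1p4 (R : countNzRingType) :
  borel_complete (@tagged_modules R).
Proof.
move=> L K _; have [m mP] := maximal_left_ideal_exists R.
have [dec [enc decK encK]] := poly_enumeration R.
exists (encode m dec enc); split.
- apply: continuous_borel_map_on; exact: encode_continuous.
- by move=> M _; exact: encode_tagged.
- by move=> M N _ _; exact: encode_iso.
Qed.
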